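(* Let $G^{\varphi}=(G,U(\mathbb{Q}),\varphi)$ be a $U(\mathbb{Q})$-gain graph of order $n$ with maximum degree $\Delta$. If $G^{\varphi}$ has no isolated vertices, then $$r(G^{\varphi})\geq\frac{n}{\Delta}.$$
   Context: $\mathbb{Q}$ denotes the skew field of real quaternions $q=x_0+x_1i+x_2j+x_3k$ ($x_0,\dots,x_3\in\mathbb{R}$), with conjugate $\bar q=x_0-x_1i-x_2j-x_3k$ and modulus $|q|=\sqrt{q\bar q}$; $U(\mathbb{Q})=\{q\in\mathbb{Q}:|q|=1\}$ is the multiplicative group of unit quaternions. A $U(\mathbb{Q})$-gain graph (quaternion unit gain graph) $G^{\varphi}=(G,U(\mathbb{Q}),\varphi)$ consists of a finite simple graph $G$ with vertices $v_1,\dots,v_n$ ($n\ge 1$ is the order) and a gain function $\varphi$ assigning to each oriented edge $e_{ij}$ (from $v_i$ to $v_j$, where $v_iv_j\in E(G)$; both orientations $e_{ij}$ and $e_{ji}$ of each edge are considered) an element $\varphi(e_{ij})=\varphi_{v_iv_j}\in U(\mathbb{Q})$ such that $\varphi(e_{ij})=\varphi(e_{ji})^{-1}=\overline{\varphi(e_{ji})}$. Its adjacency matrix $A(G^{\varphi})$ is the Hermitian $n\times n$ quaternion matrix with $(i,j)$ entry $\varphi(e_{ij})$ if $v_i$ and $v_j$ are adjacent and $0$ otherwise. The rank $r(G^{\varphi})$ is the row left rank of $A(G^{\varphi})$, i.e. the maximum number of rows of $A(G^{\varphi})$ that are left linearly independent (with respect to combinations $\sum_i q_i\alpha_i$ of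 rows $\alpha_i$ with quaternion coefficients $q_i$ multiplying on the left). Degrees of vertices, isolated vertices and the maximum degree $\Delta$ of $G^{\varphi}$ are those of the underlying graph $G$. *)

(* Defs.v *)
From HB Require Import structures.
From mathcomp Require Import all_boot all_order all_algebra.
From mathcomp Require Import boolp reals.
From mathcomp Require Import ring.

Set Implicit Arguments.
Unset Strict Implicit.
Unset Printing Implicit Defensive.

Import Order.TTheory GRing.Theory Num.Theory.

Local Open Scope ring_scope.

(* [Quat x0 x1 x2 x3] stands for x0 + x1 i + x2 j + x3 k. *)
Record quat (R : Type) : Type :=
  Quat { qre : R; qim_i : R; qim_j : R; qim_k : R }.

Section QuatRing.
Variable R : realType.
Implicit Types x y z : quat R.

Definition quat_tuple x := (qre x, qim_i x, qim_j x, qim_k x).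
Definition tuple_quat (t : R * R * R * R) : quat R :=
  Quat t.1.1.1 t.1.1.2 t.1.2 t.2.

Lemma quat_tupleK : cancel quat_tuple tuple_quat.
Proof. by case. Qed.

HB.instance Definition _ := Choice.copy (quat R) (can_type quat_tupleK).

Definition qzero : quat R := Quat 0 0 0 0.
Definition qone : quat R := Quat 1 0 0 0.
Definition qopp x := Quat (- qre x) (- qim_i x) (- qim_j x) (- qim_k x).
Definition qadd x y :=
  Quat (qre x + qre y) (qim_i x + qim_i y)
       (qim_j x + qim_j y) (qim_k x + qim_k y).

(* Bilinear extension of i^2 = j^2 = k^2 = ijk = -1. *)
Definition qmul x y :=
  let: Quat a b c d := x in
  let: Quat a' b' c' d' := y in
  Quat (a * a' - b * b' - c * c' - d * d')
       (a * b' + b * a' + c * d' - d * c')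
       (a * c' - b * d' + c * a' + d * b')
       (a * d' + b * c' - c * b' + d * a').

Lemma qaddA : associative qadd.
Proof. by move=> [????] [????] [????]; rewrite /qadd /= !addrA. Qed.

Lemma qaddC : commutative qadd.
Proof. by move=> [a b c d] [a' b' c' d']; congr Quat; apply: addrC. Qed.

Lemma qadd0 : left_id qzero qadd.
Proof. by move=> [????]; rewrite /qadd /= !add0r. Qed.

Lemma qaddN : left_inverse qzero qopp qadd.
Proof. by move=> [????]; rewrite /qadd /= !addNr. Qed.

HB.instance Definition _ :=
  GRing.isZmodule.Build (quat R) qaddA qaddC qadd0 qaddN.

Lemma qmulA : associative qmul.
Proof. by move=> [????] [????] [????]; rewrite /qmul; congr Quat; ring. Qed.

Lemma qmul1q : left_id qone qmul.
Proof. by move=> [????]; rewrite /qmul /qone /=; congr Quat; ring. Qed.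

Lemma qmulq1 : right_id qone qmul.
Proof. by move=> [????]; rewrite /qmul /qone /=; congr Quat; ring. Qed.

Lemma qmulDl : left_distributive qmul qadd.
Proof. by move=> [????] [????] [????]; rewrite /qmul /qadd /=; congr Quat; ring. Qed.

Lemma qmulDr : right_distributive qmul qadd.
Proof. by move=> [????] [????] [????]; rewrite /qmul /qadd /=; congr Quat; ring. Qed.

Lemma qone_neq0 : qone != 0.
Proof. by apply/eqP => -[] /eqP; rewrite oner_eq0. Qed.

HB.instance Definition _ :=
  GRing.Zmodule_isNzRing.Build (quat R) qmulA qmul1q qmulq1 qmulDl qmulDr
    qone_neq0.

Definition qconj x := Quat (qre x) (- qim_i x) (- qim_j x) (- qim_k x).

Definition qreal (a : R) : quat R := Quat a 0 0 0.

Definition qnormsq x : R := qre (x * qconj x).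

Definition qnorm x : R := Num.sqrt (qnormsq x).

Lemma qnormsqE x :
  qnormsq x = qre x ^+ 2 + qim_i x ^+ 2 + qim_j x ^+ 2 + qim_k x ^+ 2.
Proof. by case: x => a b c d; rewrite /qnormsq /=; ring. Qed.

Lemma qmul_conj x : x * qconj x = qreal (qnormsq x).
Proof. by rewrite qnormsqE; case: x => a b c d; congr Quat => /=; ring. Qed.

Lemma qconj_mul x : qconj x * x = qreal (qnormsq x).
Proof. by rewrite qnormsqE; case: x => a b c d; congr Quat => /=; ring. Qed.

Lemma qnormsq_ge0 x : 0 <= qnormsq x.
Proof. by rewrite qnormsqE !addr_ge0 ?sqr_ge0. Qed.

Lemma qnormsq_eq0 x : (qnormsq x == 0) = (x == 0).
Proof.
apply/idP/eqP => [|->]; last by rewrite /qnormsq mul0r.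
rewrite qnormsqE !paddr_eq0 ?addr_ge0 ?sqr_ge0 // !sqrf_eq0.
by case: x => a b c d /= /andP[/andP[/andP[/eqP-> /eqP->] /eqP->] /eqP->].
Qed.

Definition qinv x : quat R := qreal (qnormsq x)^-1 * qconj x.

Lemma qrealM a b : qreal a * qreal b = qreal (a * b).
Proof. by congr Quat => /=; ring. Qed.

Lemma qrealC a x : qreal a * x = x * qreal a.
Proof. by case: x => ????; congr Quat => /=; ring. Qed.

Lemma qmulVq : {in predC1 0, left_inverse 1 qinv *%R}.
Proof.
move=> x; rewrite inE -qnormsq_eq0 => x_neq0.
by rewrite /qinv -mulrA qconj_mul qrealM mulVf.
Qed.

Lemma qmulqV : {in predC1 0, right_inverse 1 qinv *%R}.
Proof.
move=> x; rewrite inE -qnormsq_eq0 => x_neq0.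
by rewrite /qinv qrealC mulrA qmul_conj qrealM mulfV.
Qed.

Lemma qunitP x y : y * x = 1 /\ x * y = 1 -> predC1 0 x.
Proof.
by move=> [yx1 _] /=; apply/eqP => x0; move/eqP: yx1; rewrite x0 mulr0 eq_sym oner_eq0.
Qed.

Lemma qinv_out : {in [predC predC1 (0 : quat R)], qinv =1 id}.
Proof.
move=> x; rewrite !inE negbK => /eqP->.
by rewrite /qinv /qnormsq mul0r invr0 mul0r.
Qed.

HB.instance Definition _ :=
  GRing.NzRing_hasMulInverse.Build (quat R) qmulVq qmulqV qunitP qinv_out.

Lemma qunitE x : (x \is a GRing.unit) = (x != 0).
Proof. by []. Qed.

Definition unit_quat : pred (quat R) := fun x => qnorm x == 1.

Lemma unit_quat_invE x : unit_quat x -> x^-1 = qconj x.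
Proof.
move=> /eqP; rewrite /qnorm => n1.
have s1 : qnormsq x = 1 by rewrite -(sqr_sqrtr (qnormsq_ge0 x)) n1 expr1n.
by rewrite [x^-1]/(qinv x) /qinv s1 invr1 [qreal 1]/(1 : quat R) mul1r.
Qed.

End QuatRing.

(* The values of [gain] outside the arcs of the graph are irrelevant. *)
Record gain_graph (R : realType) (n : nat) : Type := GainGraph {
  adj : rel 'I_n;
  adj_sym : symmetric adj;
  adj_irr : irreflexive adj;
  gain : 'I_n -> 'I_n -> quat R;
  gain_unit : forall i j, adj i j -> unit_quat (gain i j);
  gain_inv : forall i j, adj i j -> gain i j = (gain j i)^-1
}.

Definition degree (R : realType) (n : nat) (G : gain_graph R n) (i : 'I_n) : nat :=
  #|[set j | adj G i j]|.

Definition max_degree (R : realType) (n : nat) (G : gain_graph R n) : nat :=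
  \max_(i < n) degree G i.

Definition isolated (R : realType) (n : nat) (G : gain_graph R n) (i : 'I_n) : Prop :=
  degree G i = 0%N.

Definition adjmx (R : realType) (n : nat) (G : gain_graph R n) : 'M[quat R]_n :=
  \matrix_(i, j) if adj G i j then gain G i j else 0.

Lemma adjmx_hermitian (R : realType) (n : nat) (G : gain_graph R n) (i j : 'I_n) :
  adjmx G i j = qconj (adjmx G j i).
Proof.
rewrite !mxE (adj_sym G j i); case: ifP => [Gij|_]; last by congr Quat; rewrite /= ?oppr0.
by rewrite -unit_quat_invE ?(gain_inv Gij) // gain_unit // adj_sym.
Qed.

(* Coefficients multiply the rows on the left; MathComp's [\rank] is not
   available over a noncommutative ring. *)
Definition rows_left_indep (R : realType) (m n : nat) (A : 'M[quat R]_(m, n))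
    (S : {set 'I_m}) : Prop :=
  forall q : 'I_m -> quat R,
    (forall j : 'I_n, \sum_(i in S) q i * A i j = 0) ->
    forall i, i \in S -> q i = 0.

Definition row_left_rank (R : realType) (m n : nat) (A : 'M[quat R]_(m, n)) : nat :=
  \max_(S : {set 'I_m} | `[< rows_left_indep A S >]) #|S|.

Definition gain_rank (R : realType) (n : nat) (G : gain_graph R n) : nat :=
  row_left_rank (adjmx G).

(* Main.v *)
(* A maximum independent set S of rows of the adjacency matrix dominates the
   graph: if column j vanishes on S, then any row with a nonzero entry in
   column j could be added to S. So the neighbourhoods of the vertices of S
   cover all n vertices, whence n <= |S| * Delta. *)
Require Import Defs.
From mathcomp Require Import all_boot all_order all_algebra.
From mathcomp Require Import boolp reals.
Set Implicit Arguments.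
Unset Strict Implicit.
Unset Printing Implicit Defensive.

Import Order.TTheory GRing.Theory Num.Theory.
Local Open Scope ring_scope.

(** The empty set of rows is independent, so the maximum ranges over a nonempty family and has a
    witness. *)
Lemma row_left_rank_attained (R : realType) (m n : nat) (A : 'M[quat R]_(m, n)) :
  exists2 S : {set 'I_m}, rows_left_indep A S & row_left_rank A = #|S|.
Proof.
have indep0 : (0 < #|[pred S : {set 'I_m} | `[< rows_left_indep A S >]]|)%N.
  by apply/card_gt0P; exists set0; rewrite inE; apply/asboolP => q _ i; rewrite inE.
have [S S_indep ES] := eq_bigmax_cond (fun S : {set 'I_m} => #|S|) indep0.
by exists S => //; apply/asboolP.
Qed.

(** Column [j] isolates the new coefficient: there a vanishing combination reduces to
    [q i * A i j = 0]. Once [q i = 0], a relation among the rows of [S] alone remains. *)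
Lemma rows_left_indepU1 (R : realType) (m n : nat) (A : 'M[quat R]_(m, n))
    (S : {set 'I_m}) (i : 'I_m) (j : 'I_n) :
  rows_left_indep A S -> (forall s, s \in S -> A s j = 0) -> A i j != 0 ->
  rows_left_indep A (i |: S).
Proof.
move=> S_indep Sj0 Aij q q0.
have iS : i \notin S by apply: contraNN Aij => /Sj0 ->.
have qi0 : q i = 0.
  have := q0 j; rewrite big_setU1 //= big1 ?addr0 => [|s sS]; last first.
    by rewrite Sj0 ?mulr0.
  (* Coefficients stand on the left, so the nonzero entry is cancelled on the right. *)
  by move/(congr1 ( *%R^~ (A i j)^-1)); rewrite mul0r mulrK ?qunitE.
move=> s /setU1P[->//|sS]; apply: S_indep sS => k.
by have := q0 k; rewrite big_setU1 //= qi0 mul0r add0r.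
Qed.

Lemma unit_quat_neq0 (R : realType) (x : quat R) : unit_quat x -> x != 0.
Proof.
apply: contraTneq => ->.
by rewrite /unit_quat /qnorm /qnormsq mul0r sqrtr0 eq_sym oner_eq0.
Qed.

Lemma adjmx_eq0 (R : realType) (n : nat) (G : gain_graph R n) (i j : 'I_n) :
  (adjmx G i j == 0) = ~~ adj G i j.
Proof.
rewrite mxE; case: ifPn => [Gij|_]; last exact: eqxx.
by apply/negbTE/unit_quat_neq0/gain_unit.
Qed.

Lemma max_indep_rows_dominating (R : realType) (n : nat) (G : gain_graph R n)
    (S : {set 'I_n}) (j : 'I_n) :
  rows_left_indep (adjmx G) S -> gain_rank G = #|S| ->
  ~ isolated G j -> exists2 s, s \in S & adj G s j.
Proof.
move=> S_indep S_max /eqP; rewrite -lt0n => /card_gt0P[i]; rewrite inE adj_sym => Gij.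
apply/exists_inP; apply: contraT => /exists_inPn Sj.
have Sj0 s : s \in S -> adjmx G s j = 0 by move/Sj => Gsj; apply/eqP; rewrite adjmx_eq0.
have Aij : adjmx G i j != 0 by rewrite adjmx_eq0 negbK.
have iS : i \notin S by apply: contraNN Aij => /Sj0 ->.
have /asboolP iS_indep := rows_left_indepU1 S_indep Sj0 Aij.
(* The enlarged independent set would have [#|S| + 1] rows, more than the rank. *)
suff: (#|i |: S| <= gain_rank G)%N by rewrite S_max cardsU1 iS ltnn.
exact: (@leq_bigmax_cond _ (fun T => `[< rows_left_indep (adjmx G) T >]) (fun T => #|T|)).
Qed.

Lemma dominating_set_card (R : realType) (n : nat) (G : gain_graph R n) (S : {set 'I_n}) :
  (forall j, exists2 s, s \in S & adj G s j) -> (n <= #|S| * max_degree G)%N.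
Proof.
move=> S_dom.
have cover : [set: 'I_n] \subset \bigcup_(s in S) [set j | adj G s j].
  apply/subsetP => j _; have [s sS Gsj] := S_dom j.
  by apply/bigcupP; exists s => //; rewrite inE.
rewrite -{1}(card_ord n) -cardsT (leq_trans (subset_leq_card cover)) //.
(* Union bound: each neighbourhood in the cover contributes at most [max_degree G]. *)
rewrite -sum_nat_const; elim/big_rec2: _ => [|s N T _ leTN]; first by rewrite cards0.
apply: leq_trans (leq_card_setU _ _) (leq_add _ leTN).
exact: (leq_bigmax (F := degree G)).
Qed.

Theorem theorem3p2 (R : realType) (n : nat) (G : gain_graph R n)
    (n_gt0 : (0 < n)%N)
    (no_isolated : forall i : 'I_n, ~ isolated G i) :
  (gain_rank G)%:R >= n%:R / (max_degree G)%:R :> R.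
Proof.
have [S S_indep S_max] := row_left_rank_attained (adjmx G).
have n_le : (n <= gain_rank G * max_degree G)%N.
  rewrite /gain_rank S_max; apply: dominating_set_card => j.
  exact: max_indep_rows_dominating.
(* A zero maximum degree would turn [n_le] into [n <= 0]. *)
have Delta_gt0 : (0 < max_degree G)%N.
  by case: (max_degree G) n_le => //; rewrite muln0 leqNgt n_gt0.
by rewrite ler_pdivrMr ?ltr0n // -natrM ler_nat.
Qed.
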